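(* Let $m_1,m_2>0$. Every solution of the three-body problem of the type described in the context with $c_1\neq 0$, $c_2<0$ and $$8m_1m_2^2+m_2^3+16c_2c_1^2<0$$ is bounded, i.e. the positions $x(t),y(t),z(t)$ remain in a bounded subset of $\mathbb{R}^3$ for all time.
   Context: The gravitational constant is $1$. The solutions considered are the solutions of the three-body problem with masses $m_1,m_2,m_2$ (positions $x,y,z\in\mathbb{R}^3$) of the form $$x=(0,0,f),\quad y=\Big(r\cos\theta,\,r\sin\theta,\,-\tfrac{m_1}{2m_2}f\Big),\quad z=\Big(-r\cos\theta,\,-r\sin\theta,\,-\tfrac{m_1}{2m_2}f\Big),$$ where $r>0$ and $$\ddot f=-\frac{2m_2kf}{h^3},\qquad \ddot r=\frac{c_1^2}{r^3}-\frac{m_2}{4r^2}-2(k-1)m_2\frac{r}{h^3},\qquad r^2\dot\theta=c_1,$$ with $k=\frac{m_1+2m_2}{2m_2}$, $h=\sqrt{r^2+k^2f^2}$ and $c_1$ a constant. The conserved total energy is $$c_2=\frac{m_2c_1^2}{r^2}-\frac{2m_1m_2}{h}-\frac{m_2^2}{2r}+\frac{m_1^2+2m_1m_2}{4m_2}\dot f^2+m_2\dot r^2 .$$ *)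

(* Defs.v *)
From Stdlib Require Import Reals.
From Coquelicot Require Import Coquelicot.
Open Scope R_scope.

(* The norm of Coquelicot's product of normed modules is
   sqrt (norm u ^ 2 + norm v ^ 2), so the norm of R3 is the Euclidean one. *)
Definition R3 : NormedModule R_AbsRing :=
  prod_NormedModule R_AbsRing
    (prod_NormedModule R_AbsRing R_NormedModule R_NormedModule) R_NormedModule.

Definition vec3 (u v w : R) : R3 := (u, v, w).

(* Open time interval ]a, b[; a = m_infty and b = p_infty are allowed. *)
Definition in_interval (a b : Rbar) (t : R) : Prop := Rbar_lt a t /\ Rbar_lt t b.

Definition attraction (m : R) (p q : R3) : R3 :=
  scal (m / norm (minus q p) ^ 3) (minus q p).

(* Newton's equations, gravitational constant 1, without collisions. *)
Definition three_body_solution (m1 m2 m3 : R) (a b : Rbar) (x y z : R -> R3) : Prop :=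
  (forall t, in_interval a b t -> x t <> y t /\ x t <> z t /\ y t <> z t) /\
  exists vx vy vz : R -> R3, forall t, in_interval a b t ->
    is_derive x t (vx t) /\ is_derive y t (vy t) /\ is_derive z t (vz t) /\
    is_derive vx t (plus (attraction m2 (x t) (y t)) (attraction m3 (x t) (z t))) /\
    is_derive vy t (plus (attraction m1 (y t) (x t)) (attraction m3 (y t) (z t))) /\
    is_derive vz t (plus (attraction m1 (z t) (x t)) (attraction m2 (z t) (y t))).

Definition posx (f : R -> R) (t : R) : R3 := vec3 0 0 (f t).

Definition posy (m1 m2 : R) (f r theta : R -> R) (t : R) : R3 :=
  vec3 (r t * cos (theta t)) (r t * sin (theta t)) (- (m1 / (2 * m2)) * f t).

Definition posz (m1 m2 : R) (f r theta : R -> R) (t : R) : R3 :=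
  vec3 (- (r t * cos (theta t))) (- (r t * sin (theta t))) (- (m1 / (2 * m2)) * f t).

Definition kcoef (m1 m2 : R) : R := (m1 + 2 * m2) / (2 * m2).

Definition hdist (m1 m2 : R) (f r : R -> R) (t : R) : R :=
  sqrt (r t ^ 2 + kcoef m1 m2 ^ 2 * f t ^ 2).

Definition isosceles_solution (m1 m2 c1 : R) (f r theta : R -> R) (a b : Rbar) : Prop :=
  three_body_solution m1 m2 m2 a b (posx f) (posy m1 m2 f r theta) (posz m1 m2 f r theta) /\
  forall t, in_interval a b t ->
    0 < r t /\
    ex_derive f t /\
    is_derive (Derive f) t (- (2 * m2 * kcoef m1 m2 * f t / hdist m1 m2 f r t ^ 3)) /\
    ex_derive r t /\
    is_derive (Derive r) t
      (c1 ^ 2 / r t ^ 3 - m2 / (4 * r t ^ 2)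
       - 2 * (kcoef m1 m2 - 1) * m2 * (r t / hdist m1 m2 f r t ^ 3)) /\
    ex_derive theta t /\
    r t ^ 2 * Derive theta t = c1.

Definition energy (m1 m2 c1 : R) (f r : R -> R) (t : R) : R :=
  m2 * c1 ^ 2 / r t ^ 2 - 2 * m1 * m2 / hdist m1 m2 f r t - m2 ^ 2 / (2 * r t)
  + (m1 ^ 2 + 2 * m1 * m2) / (4 * m2) * Derive f t ^ 2 + m2 * Derive r t ^ 2.

(* Main.v *)
(** The energy is conserved.  Completing the square in [1/r],
    [m2 c1^2/r^2 - m2^2/(2r) >= - m2^3/(16 c1^2)], so the energy identity gives
    [2 m1 m2 / h >= - m2^3/(16 c1^2) - c2], and the right-hand side is positive
    by hypothesis: [h] is bounded.  Since [k = 1 + m1/(2 m2)], the three bodies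
    stay within distance [h] of the origin. *)
Require Import Defs.
From Stdlib Require Import Reals Lra.
From Coquelicot Require Import Coquelicot.
Open Scope R_scope.

Lemma norm_vec3 (u v w : R) : norm (vec3 u v w) = sqrt (u ^ 2 + v ^ 2 + w ^ 2).
Proof.
change (sqrt (sqrt (Rabs u ^ 2 + Rabs v ^ 2) ^ 2 + Rabs w ^ 2)
        = sqrt (u ^ 2 + v ^ 2 + w ^ 2)).
rewrite pow2_sqrt, !pow2_abs; [reflexivity|].
pose proof (pow2_ge_0 (Rabs u)); pose proof (pow2_ge_0 (Rabs v)); lra.
Qed.

Lemma in_interval_between (a b : Rbar) (s t u : R) :
  in_interval a b s -> in_interval a b u -> s <= t <= u -> in_interval a b t.
Proof.
intros [Has _] [_ Hub] [Hst Htu]; split.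
- exact (Rbar_lt_le_trans a s t Has Hst).
- exact (Rbar_le_lt_trans t u b Htu Hub).
Qed.

(** The interval may be unbounded, so the mean value argument runs on the segment between the two
    times, which convexity keeps inside. *)
Lemma is_derive_0_const (g : R -> R) (a b : Rbar) :
  (forall t, in_interval a b t -> is_derive g t 0) ->
  forall s t, in_interval a b s -> in_interval a b t -> g s = g t.
Proof.
intros Hg s t Hs Ht.
assert (Hlt : forall u v, in_interval a b u -> in_interval a b v -> u < v -> g u = g v).
{ intros u v Hu Hv Huv.
  apply (eq_is_derive g u v); [|exact Huv].
  intros w Hw; apply Hg; exact (in_interval_between a b u w v Hu Hv Hw). }
destruct (Rtotal_order s t) as [H|[->|H]].
- now apply Hlt.
- reflexivity.
- symmetry; now apply Hlt.
Qed.

Lemma kcoef_eq (m1 m2 : R) : m2 <> 0 -> kcoef m1 m2 = 1 + m1 / (2 * m2).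
Proof. intros H; unfold kcoef; field; exact H. Qed.

Lemma hdist_arg_pos (k r f : R) : 0 < r -> 0 < r ^ 2 + k ^ 2 * f ^ 2.
Proof.
intros Hr; pose proof (pow_lt r 2 Hr); pose proof (pow2_ge_0 (k * f)).
rewrite Rpow_mult_distr in *; lra.
Qed.

Lemma hdist_pos (m1 m2 : R) (f r : R -> R) (t : R) : 0 < r t -> 0 < hdist m1 m2 f r t.
Proof. intros Hr; apply sqrt_lt_R0, hdist_arg_pos, Hr. Qed.

Lemma is_derive_hdist (m1 m2 : R) (f r : R -> R) (t : R) :
  0 < r t -> ex_derive f t -> ex_derive r t ->
  is_derive (hdist m1 m2 f r) t
    ((r t * Derive r t + kcoef m1 m2 ^ 2 * f t * Derive f t) / hdist m1 m2 f r t).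
Proof.
intros Hr Hf Hdr.
pose proof (hdist_pos m1 m2 f r t Hr) as Hh.
unfold hdist in *; auto_derive.
- repeat split; auto.
  pose proof (hdist_arg_pos (kcoef m1 m2) (r t) (f t) Hr); simpl in *; lra.
(* Refolding the radicand lets [field] see one and the same square root on both sides. *)
- match goal with |- context [/ (2 * sqrt ?x)] =>
    replace x with (r t ^ 2 + kcoef m1 m2 ^ 2 * f t ^ 2) by ring end.
  change (fun x => f x) with f; change (fun x => r x) with r.
  field; lra.
Qed.

(** The equation for [r] is weighted by $2m_2\dot r$ and that for [f] by $m_1k\dot f$. The terms in
    $1/r$ cancel at once; those in [h] cancel because $2m_2(k-1)=m_1$ and $h\dot h=r\dot r+k^2f\dot
    f$. *)
Lemma is_derive_energy (m1 m2 c1 : R) (f r theta : R -> R) (a b : Rbar) (t : R) :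
  0 < m2 -> isosceles_solution m1 m2 c1 f r theta a b -> in_interval a b t ->
  is_derive (energy m1 m2 c1 f r) t 0.
Proof.
intros Hm2 [_ Hsol] Ht.
destruct (Hsol t Ht) as (Hr & Hf & Hf2 & Hdr & Hr2 & _).
pose proof (hdist_pos m1 m2 f r t Hr) as Hh.
pose proof (is_derive_hdist m1 m2 f r t Hr Hf Hdr) as Hdh.
unfold energy; auto_derive.
- repeat split; auto; try lra;
    try (apply Rgt_not_eq; nra); eexists; eassumption.
- change (fun x => f x) with f; change (fun x => r x) with r.
  change (fun x => hdist m1 m2 f r x) with (hdist m1 m2 f r).
  change (fun x => Derive f x) with (Derive f).
  change (fun x => Derive r x) with (Derive r).
  rewrite (is_derive_unique _ _ _ Hdh), (is_derive_unique _ _ _ Hf2),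
    (is_derive_unique _ _ _ Hr2).
  unfold kcoef; field; lra.
Qed.

(** The two sides differ by $m(c/r-m/(4c))^2$, which vanishes at $r=4c^2/m$, the circular orbit of
    the pair of equal masses alone. *)
Lemma centrifugal_kepler_ge (m c r : R) : 0 < m -> c <> 0 -> r <> 0 ->
  - (m ^ 3 / (16 * c ^ 2)) <= m * c ^ 2 / r ^ 2 - m ^ 2 / (2 * r).
Proof.
intros Hm Hc Hr.
assert (H : m * c ^ 2 / r ^ 2 - m ^ 2 / (2 * r) + m ^ 3 / (16 * c ^ 2)
            = m * (c / r - m / (4 * c)) ^ 2) by (field; split; assumption).
pose proof (Rmult_le_pos _ _ (Rlt_le _ _ Hm) (pow2_ge_0 (c / r - m / (4 * c)))).
lra.
Qed.

Lemma hdist_le_of_energy (m1 m2 c1 : R) (f r : R -> R) (t : R) :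
  0 < m1 -> 0 < m2 -> c1 <> 0 -> 0 < r t ->
  m2 ^ 3 / (16 * c1 ^ 2) + energy m1 m2 c1 f r t < 0 ->
  hdist m1 m2 f r t
    <= 2 * m1 * m2 / - (m2 ^ 3 / (16 * c1 ^ 2) + energy m1 m2 c1 f r t).
Proof.
intros Hm1 Hm2 Hc1 Hr HE.
set (d := m2 ^ 3 / (16 * c1 ^ 2) + energy m1 m2 c1 f r t) in *.
pose proof (hdist_pos m1 m2 f r t Hr) as Hh.
assert (Hd : - d <= 2 * m1 * m2 / hdist m1 m2 f r t).
{ assert (Hr0 : r t <> 0) by lra.
  pose proof (centrifugal_kepler_ge m2 c1 (r t) Hm2 Hc1 Hr0).
  assert (0 <= (m1 ^ 2 + 2 * m1 * m2) / (4 * m2) * Derive f t ^ 2).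
  { apply Rmult_le_pos; [|apply pow2_ge_0].
    apply Rlt_le, Rdiv_lt_0_compat; nra. }
  assert (0 <= m2 * Derive r t ^ 2)
    by (apply Rmult_le_pos; [lra|apply pow2_ge_0]).
  unfold d, energy; lra. }
apply (Rmult_le_compat_r _ _ _ (Rlt_le _ _ Hh)) in Hd.
replace (2 * m1 * m2 / hdist m1 m2 f r t * hdist m1 m2 f r t)
  with (2 * m1 * m2) in Hd by (field; lra).
apply Rle_div_r; lra.
Qed.

(** With $q=m_1/(2m_2)>0$ and $k=1+q$, the heights $|f|$ and $q|f|$ are both at most $k|f|$, and the
    distances to the axis are $0$ and $r$. *)
Lemma norm_pos_le_hdist (m1 m2 : R) (f r theta : R -> R) (t : R) :
  0 < m1 -> 0 < m2 ->
  norm (posx f t) <= hdist m1 m2 f r t /\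
  norm (posy m1 m2 f r theta t) <= hdist m1 m2 f r t /\
  norm (posz m1 m2 f r theta t) <= hdist m1 m2 f r t.
Proof.
intros Hm1 Hm2.
unfold posx, posy, posz, hdist; rewrite !norm_vec3, kcoef_eq by lra.
assert (Hq : 0 < m1 / (2 * m2)) by (apply Rdiv_lt_0_compat; lra).
set (q := m1 / (2 * m2)) in *.
pose proof (pow2_ge_0 (r t)).
pose proof (pow2_ge_0 (f t)).
assert (Hcs : cos (theta t) ^ 2 + sin (theta t) ^ 2 = 1)
  by (pose proof (sin2_cos2 (theta t)); unfold Rsqr in *; lra).
(* The signs of $qf^2$ and $q^2f^2$, monomials of $(1+q)^2f^2$, make the comparisons linear. *)
assert (Hf : 0 <= q * f t ^ 2) by (apply Rmult_le_pos; lra).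
assert (Hf2 : 0 <= q * (q * f t ^ 2)) by (apply Rmult_le_pos; lra).
assert (Hyz : r t ^ 2 + q ^ 2 * f t ^ 2 <= r t ^ 2 + (1 + q) ^ 2 * f t ^ 2) by lra.
repeat split; apply sqrt_le_1_alt.
- lra.
- replace ((r t * cos (theta t)) ^ 2 + (r t * sin (theta t)) ^ 2 + (- q * f t) ^ 2)
    with (r t ^ 2 * (cos (theta t) ^ 2 + sin (theta t) ^ 2) + q ^ 2 * f t ^ 2) by ring.
  rewrite Hcs; lra.
- replace ((- (r t * cos (theta t))) ^ 2 + (- (r t * sin (theta t))) ^ 2
           + (- q * f t) ^ 2)
    with (r t ^ 2 * (cos (theta t) ^ 2 + sin (theta t) ^ 2) + q ^ 2 * f t ^ 2) by ring.
  rewrite Hcs; lra.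
Qed.

Theorem theorem2p6 (m1 m2 c1 c2 : R) (a b : Rbar) (t0 : R) (f r theta : R -> R)
  (hm1 : 0 < m1) (hm2 : 0 < m2)
  (hsol : isosceles_solution m1 m2 c1 f r theta a b)
  (ht0 : in_interval a b t0)
  (hc2 : energy m1 m2 c1 f r t0 = c2)
  (hc1 : c1 <> 0)
  (hneg : c2 < 0)
  (hineq : 8 * m1 * m2 ^ 2 + m2 ^ 3 + 16 * c2 * c1 ^ 2 < 0) :
  exists M : R, forall t : R, in_interval a b t ->
    norm (posx f t) <= M /\
    norm (posy m1 m2 f r theta t) <= M /\
    norm (posz m1 m2 f r theta t) <= M.
Proof.
(* This is the bound on [h] with the energy replaced by its constant value [c2], hence independent
   of [t]. *)
exists (2 * m1 * m2 / - (m2 ^ 3 / (16 * c1 ^ 2) + c2)); intros t Ht.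
assert (HE : energy m1 m2 c1 f r t = c2).
{ rewrite <- hc2; apply (is_derive_0_const _ a b); [|exact Ht|exact ht0].
  intros s Hs; exact (is_derive_energy m1 m2 c1 f r theta a b s hm2 hsol Hs). }
assert (Hr : 0 < r t) by (destruct hsol as [_ H]; apply (H t Ht)).
(* Since $8m_1m_2^2>0$, [hineq] yields $m_2^3<-16c_2c_1^2$; division by $16c_1^2$ gives the sign. *)
assert (Hd : m2 ^ 3 / (16 * c1 ^ 2) + c2 < 0).
{ assert (Hc : 0 < 16 * c1 ^ 2) by (pose proof (pow2_gt_0 c1 hc1); lra).
  pose proof (Rmult_lt_0_compat _ _ hm1 (pow_lt m2 2 hm2)).
  assert (m2 ^ 3 / (16 * c1 ^ 2) < - c2) by (apply Rlt_div_l; lra).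
  lra. }
rewrite <- HE in Hd |- *.
pose proof (hdist_le_of_energy m1 m2 c1 f r t hm1 hm2 hc1 Hr Hd).
destruct (norm_pos_le_hdist m1 m2 f r theta t hm1 hm2) as (Hx & Hy & Hz).
repeat split; eapply Rle_trans; eassumption.
Qed.
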